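(* Let $k$ be an indeterminate and define $$a(k)=10k^2-8k+8,\qquad b(k)=k(k^2-4k+20),\qquad c(k)=(k+2)(k^2-4).$$ Let $E$ be the elliptic curve over $\mathbb{Q}(k)$ given by $$y^2=\big(x+a(k)b(k)\big)\big(x+b(k)c(k)\big)\big(x+a(k)c(k)\big).$$ Then the Mordell–Weil rank of $E(\mathbb{Q}(k))$ is at least $2$. *)

(* Defs.v *)
From HB Require Import structures.
From mathcomp Require Import all_boot all_order all_algebra.
From mathcomp Require Import fraction.
Set Implicit Arguments. Unset Strict Implicit. Unset Printing Implicit Defensive.
Import Order.TTheory GRing.Theory Num.Theory.
Local Open Scope ring_scope.

(* ---------- Elliptic curves in short-ish Weierstrass form over a field ----
   E : y^2 = x^3 + a2 x^2 + a4 x + a6  (a1 = a3 = 0).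
   Points of E(K): [None] is the point at infinity O, [Some (x,y)] an affine
   point. The group law is the usual chord-and-tangent law. *)
Section EllipticCurve.
Variable K : fieldType.

Definition ec_point := option (K * K).

Definition on_curve (a2 a4 a6 : K) (P : ec_point) : bool :=
  match P with
  | None => true
  | Some (x, y) => y ^+ 2 == x ^+ 3 + a2 * x ^+ 2 + a4 * x + a6
  end.

Definition ec_neg (P : ec_point) : ec_point :=
  match P with
  | None => None
  | Some (x, y) => Some (x, - y)
  end.

Definition ec_add (a2 a4 a6 : K) (P Q : ec_point) : ec_point :=
  match P, Q with
  | None, _ => Q
  | _, None => P
  | Some (x1, y1), Some (x2, y2) =>
    if (x1 == x2) && (y1 == - y2) then None
    else
      let l := if x1 == x2
               then (3%:R * x1 ^+ 2 + 2%:R * a2 * x1 + a4) / (2%:R * y1)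
               else (y2 - y1) / (x2 - x1) in
      let x3 := l ^+ 2 - a2 - x1 - x2 in
      Some (x3, l * (x1 - x3) - y1)
  end.

Fixpoint ec_muln (a2 a4 a6 : K) (n : nat) (P : ec_point) : ec_point :=
  match n with
  | 0%N => None
  | n'.+1 => ec_add a2 a4 a6 P (ec_muln a2 a4 a6 n' P)
  end.

Definition ec_mulz (a2 a4 a6 : K) (m : int) (P : ec_point) : ec_point :=
  match m with
  | Posz n => ec_muln a2 a4 a6 n P
  | Negz n => ec_neg (ec_muln a2 a4 a6 n.+1 P)
  end.

Definition mw_rank_ge (a2 a4 a6 : K) (r : nat) : Prop :=
  exists P : 'I_r -> ec_point,
    (forall i, on_curve a2 a4 a6 (P i)) /\
    forall c : 'I_r -> int,
      foldr (ec_add a2 a4 a6) None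
            [seq ec_mulz a2 a4 a6 (c i) (P i) | i <- enum 'I_r] = None ->
      forall i, c i = 0.

(* The curve y^2 = (x + e1)(x + e2)(x + e3), expanded into Weierstrass form. *)
Definition mw_rank_ge_roots (e1 e2 e3 : K) (r : nat) : Prop :=
  mw_rank_ge (e1 + e2 + e3) (e1 * e2 + e1 * e3 + e2 * e3) (e1 * e2 * e3) r.

End EllipticCurve.

Definition Qk : fieldType := {fraction {poly rat}}.
Definition kvar : Qk := FracField.tofrac ('X : {poly rat}).

Definition a_k : Qk := 10%:R * kvar ^+ 2 - 8%:R * kvar + 8%:R.
Definition b_k : Qk := kvar * (kvar ^+ 2 - 4%:R * kvar + 20%:R).
Definition c_k : Qk := (kvar + 2%:R) * (kvar ^+ 2 - 4%:R).

(* Main.v *)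
Require Import Defs.
From mathcomp Require Import all_boot all_order all_algebra.
From mathcomp Require Import fraction.
From mathcomp Require Import ring zify.
Set Implicit Arguments. Unset Strict Implicit. Unset Printing Implicit Defensive.
Import Order.TTheory GRing.Theory Num.Theory.
Local Open Scope ring_scope.

(** With [x = k^6 X], [y = k^9 Y], the curve [E] degenerates at the place
    [k = oo] to the split nodal cubic [Y^2 = X^2 (X + 1)], whose smooth locus is
    the multiplicative group of [rat].  The two points chosen below reduce to the
    parameters 3 and 5.  Since the powers of these rationals stay away from 1 and
    from each other, every chord occurring in the computation of [m P] already has
    a non-vertical reduction (apart from one tangent, for [2 P]), so [m P] reduces
    to the parameter [3^m] and [n Q] to [5^n] without any appeal to associativity
    of the group law.  A relation [m P + n Q = O] would force [3^|m| = 5^|n|]. *)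

(** * Leading coefficients at infinity *)

Definition frac (p : {poly rat}) : Qk := FracField.tofrac p.

Lemma fracD p q : frac (p + q) = frac p + frac q.
Proof. exact: tofracD. Qed.

Lemma fracM p q : frac (p * q) = frac p * frac q.
Proof. exact: tofracM. Qed.

Lemma frac1 : frac 1 = 1.
Proof. exact: tofrac1. Qed.

Lemma frac_eq0 p : (frac p == 0) = (p == 0).
Proof. exact: tofrac_eq0. Qed.

Lemma frac_int (z : int) : frac z%:~R = z%:~R.
Proof. exact: (rmorph_int (@FracField.tofrac {poly rat})). Qed.

(* [f = v k^i + lower order terms]; [v] is allowed to be 0. *)
Definition asym (i : nat) (f : Qk) (v : rat) : Prop :=
  exists n (p q : {poly rat}),
    [/\ f = frac p / frac q,
        (size p <= (n + i).+1)%N, (size q <= n.+1)%N,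
        q`_n != 0 & v = p`_(n + i) / q`_n].

Lemma size_mul_bound (R : nzRingType) (p q : {poly R}) m n :
  (size p <= m.+1)%N -> (size q <= n.+1)%N -> (size (p * q)%R <= (m + n).+1)%N.
Proof.
move=> hp hq; apply: leq_trans (size_polyMleq _ _) _.
by move: hp hq; lia.
Qed.

Lemma coef_mul_top (R : nzRingType) (p q : {poly R}) m n :
  (size p <= m.+1)%N -> (size q <= n.+1)%N ->
  (p * q)`_(m + n) = p`_m * q`_n.
Proof.
move=> hp hq; rewrite coefM.
have hm : (m < (m + n).+1)%N by rewrite ltnS leq_addr.
rewrite (bigD1 (Ordinal hm)) //= addKn big1 ?addr0 // => -[j hj] /=.
rewrite -val_eqE /= => jm; case: (ltngtP j m) jm => // jm _.
- by rewrite [q`_ _]nth_default ?mulr0 //; apply: leq_trans hq _; lia.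
- by rewrite nth_default ?mul0r //; apply: leq_trans hp _.
Qed.

Lemma frac_coef_neq0 (q : {poly rat}) n :
  q`_n != 0 -> frac q != 0.
Proof. by rewrite frac_eq0; apply: contraNneq => ->; rewrite coef0. Qed.

Lemma asym_poly i (p : {poly rat}) :
  (size p <= i.+1)%N -> asym i (frac p) p`_i.
Proof.
move=> hp; exists 0%N, p, 1; split=> //.
- by rewrite frac1 divr1.
- by rewrite size_poly1.
- by rewrite coef1 oner_neq0.
- by rewrite coef1 divr1.
Qed.

Lemma asymM i j f g v w : asym i f v -> asym j g w -> asym (i + j) (f * g) (v * w).
Proof.
move=> [m [p [q [-> hp hq q0 ->]]]] [n [r [s [-> hr hs s0 ->]]]].
exists (m + n)%N, (p * r), (q * s); split.
- by rewrite !fracM mulf_div.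
- by rewrite addnACA; apply: size_mul_bound.
- exact: size_mul_bound.
- by rewrite coef_mul_top // mulf_neq0.
- by rewrite addnACA !coef_mul_top // mulf_div.
Qed.

Lemma asymD i f g v w : asym i f v -> asym i g w -> asym i (f + g) (v + w).
Proof.
move=> [m [p [q [-> hp hq q0 ->]]]] [n [r [s [-> hr hs s0 ->]]]].
have Ep : (m + n + i = m + i + n)%N by lia.
have Er : (m + n + i = n + i + m)%N by lia.
have hps : (size (p * s)%R <= (m + n + i).+1)%N.
  by rewrite Ep; apply: size_mul_bound.
have hrq : (size (r * q)%R <= (m + n + i).+1)%N.
  by rewrite Er; apply: size_mul_bound.
exists (m + n)%N, (p * s + r * q), (q * s); split.
- rewrite fracD !fracM addf_div //.
  + exact: frac_coef_neq0 q0.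
  + exact: frac_coef_neq0 s0.
- by apply: leq_trans (size_polyD _ _) _; rewrite geq_max hps hrq.
- exact: size_mul_bound.
- by rewrite coef_mul_top // mulf_neq0.
- by rewrite coefD {1}Ep Er !coef_mul_top // addf_div.
Qed.

(** As [w != 0], the numerator of [g] has a nonzero coefficient in degree [n + j], so it can enter
    the new denominator. *)
Lemma asym_div i j f g v w :
  asym (i + j) f v -> asym j g w -> w != 0 -> asym i (f / g) (v / w).
Proof.
move=> [m [p [q [-> hp hq q0 ->]]]] [n [r [s [-> hr hs s0 ->]]]] w0.
have r0 : r`_(n + j) != 0 by apply: contraNneq w0 => ->; rewrite mul0r.
have E : (m + (n + j) + i = m + (i + j) + n)%N by lia.
exists (m + (n + j))%N, (p * s), (q * r); split.
- by rewrite !fracM invf_div mulf_div.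
- by rewrite E; apply: size_mul_bound.
- exact: size_mul_bound.
- by rewrite coef_mul_top // mulf_neq0.
- by rewrite E !coef_mul_top // invf_div mulf_div.
Qed.

Lemma asym_cst (z : int) : asym 0 z%:~R z%:~R.
Proof.
rewrite -frac_int -(rmorph_int (@polyC rat)).
rewrite -[X in asym _ _ X](@coefC rat z%:~R 0); apply: asym_poly.
exact: size_polyC_leq1.
Qed.

Lemma asym_kvar : asym 1 kvar 1.
Proof. by have := @asym_poly 1 'X; rewrite size_polyX coefX; apply. Qed.

Lemma asymN i f v : asym i f v -> asym i (- f) (- v).
Proof. by move=> /(asymM (asym_cst (-1))); rewrite !mulN1r. Qed.

Lemma asymB i f g v w : asym i f v -> asym i g w -> asym i (f - g) (v - w).
Proof. by move=> hf /asymN; apply: asymD. Qed.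

Lemma asym_lt i j f v : (i < j)%N -> asym i f v -> asym j f 0.
Proof.
move=> ij [m [p [q [-> hp hq q0 _]]]]; exists m, p, q; split=> //.
- by apply: leq_trans hp _; rewrite ltnS leq_add2l ltnW.
- by rewrite nth_default ?mul0r //; apply: leq_trans hp _; rewrite -addnS leq_add2l.
Qed.

Lemma asym_0 i v : asym i 0 v -> v = 0.
Proof.
move=> [m [p [q [/esym/eqP]]]]; rewrite mulf_eq0 invr_eq0 !frac_eq0.
move=> /orP [] /eqP -> hp hq; last by rewrite coef0 eqxx.
by rewrite coef0 mul0r.
Qed.

Lemma asym_neq0 i f v : asym i f v -> v != 0 -> f != 0.
Proof. by move=> hf; apply: contraNneq => f0; rewrite f0 in hf; apply/eqP/(asym_0 hf). Qed.

Lemma asym_uniq i f v w : asym i f v -> asym i f w -> v = w.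
Proof. by move=> hv /(asymB hv); rewrite subrr => /asym_0/subr0_eq. Qed.

(** Horner form, constant coefficient first: the leading term is read off the list, and [ring]
    applies after unfolding. *)
Definition kpoly (s : seq int) : Qk := foldr (fun c f => c%:~R + kvar * f) 0 s.

Lemma asym_kpoly s : asym (size s).-1 (kpoly s) (last 0 s)%:~R.
Proof.
elim: s => [|c [|d s] IHs] /=; first exact: (asym_cst 0).
  by rewrite mulr0 addr0; apply: asym_cst.
have -> : (last d s)%:~R = 0 + 1 * (last d s)%:~R :> rat by rewrite add0r mul1r.
apply: asymD; first exact: asym_lt (asym_cst c).
by rewrite -add1n; apply: asymM asym_kvar IHs.
Qed.

(** * The nodal cubic *)

(** Parametrisation of [Y^2 = X^2 (X + 1)] by [t = (Y + X) / (Y - X)]: [t = 1] is the point at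
    infinity, [t = 0] the node, and inverting [t] negates the point. *)
Definition nodeX (t : rat) : rat := 4 * t / (t - 1) ^+ 2.
Definition nodeY (t : rat) : rat := 4 * t * (t + 1) / (t - 1) ^+ 3.

Definition reduces (P : ec_point Qk) (t : rat) : Prop :=
  exists x y, [/\ P = Some (x, y), asym 6 x (nodeX t) & asym 9 y (nodeY t)].

(** The factors [t - s] and [1 - s * t] are the two ways for abscissas to agree: the same point, or
    opposite points. *)
Lemma nodeX_sub (s t : rat) : s != 1 -> t != 1 ->
  nodeX t - nodeX s = 4 * (t - s) * (1 - s * t) / ((t - 1) ^+ 2 * (s - 1) ^+ 2).
Proof.
by rewrite -subr_eq0 -[t == _]subr_eq0 /nodeX => hs ht; field; rewrite hs ht.
Qed.

Lemma nodeX_sub_neq0 (s t : rat) : s != 1 -> t != 1 -> s != t -> s * t != 1 ->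
  nodeX t - nodeX s != 0.
Proof.
move=> s1 t1 st st1; rewrite nodeX_sub // !mulf_neq0 ?invr_eq0 //.
- by rewrite subr_eq0 eq_sym.
- by rewrite subr_eq0 eq_sym.
- by rewrite mulf_neq0 // expf_neq0 // subr_eq0.
Qed.

Lemma nodeX_inj (s t : rat) : 1 < s -> 1 < t -> nodeX s = nodeX t -> s = t.
Proof.
move=> hs ht E; apply: contra_eq E => st.
rewrite eq_sym -subr_eq0; apply: nodeX_sub_neq0 => //; rewrite gt_eqF //.
by rewrite mulr_egt1.
Qed.

(** * Chords, tangents and multiples under reduction *)

Section Multiples.
Variables a2 a4 a6 : Qk.
Hypothesis ha2 : asym 6 a2 1.
Hypothesis ha4 : asym 12 a4 0.

(** Distinct leading coefficients of the abscissas force [x1 != x2], so the chord formula applies,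
    and its slope has as leading coefficient the slope [L] of the chord of the nodal cubic. *)
Lemma reduces_chord P Q (s t : rat) : s != 1 -> t != 1 -> s != t -> s * t != 1 ->
  reduces P s -> reduces Q t -> reduces (ec_add a2 a4 a6 P Q) (s * t).
Proof.
move=> s1 t1 st st1 [x1 [y1 [-> hx1 hy1]]] [x2 [y2 [-> hx2 hy2]]].
have hd := asymB hx2 hx1.
have d0 : nodeX t - nodeX s != 0 by apply: nodeX_sub_neq0.
have x12 : (x1 == x2) = false.
  by apply/negP=> /eqP E; move: (asym_neq0 hd d0); rewrite E subrr eqxx.
rewrite /= x12 /=.
have hl := asym_div (i := 3) (j := 6) (asymB hy2 hy1) hd d0.
set l := (y2 - y1) / _ in hl *; set L := (nodeY t - _) / _ in hl.
have hx3 := asymB (asymB (asymB (asymM hl hl) ha2) hx1) hx2.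
have s1' : s - 1 != 0 by rewrite subr_eq0.
have t1' : t - 1 != 0 by rewrite subr_eq0.
have st1' : s * t - 1 != 0 by rewrite subr_eq0.
have ts' : t - s != 0 by rewrite subr_eq0 eq_sym.
have st1'' : 1 - s * t != 0 by rewrite subr_eq0 eq_sym.
have EX : L * L - 1 - nodeX s - nodeX t = nodeX (s * t).
  rewrite /L nodeX_sub // /nodeX /nodeY; field.
  by apply/and5P.
exists (l ^+ 2 - a2 - x1 - x2), (l * (x1 - (l ^+ 2 - a2 - x1 - x2)) - y1); split=> //.
  by rewrite -EX expr2.
have -> : nodeY (s * t) = L * (nodeX s - nodeX (s * t)) - nodeY s.
  rewrite /L nodeX_sub // /nodeX /nodeY; field.
  by apply/and5P.
apply: asymB hy1; apply: asymM hl _; apply: asymB hx1 _.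
by rewrite -EX expr2.
Qed.

(** Excluding 0 and -1 keeps the leading coefficient of [2 y] nonzero, so the tangent is not
    vertical. *)
Lemma reduces_double P (t : rat) : t != 0 -> t != 1 -> t != - 1 ->
  reduces P t -> reduces (ec_add a2 a4 a6 P P) (t * t).
Proof.
move=> t0 t1 tN1 [x [y [-> hx hy]]].
have t1' : t - 1 != 0 by rewrite subr_eq0.
have tN1' : t + 1 != 0 by rewrite addr_eq0.
have tt1 : t * t - 1 != 0.
  by have -> : t * t - 1 = (t - 1) * (t + 1); [ring | rewrite mulf_neq0].
have h2y := asymM (asym_cst 2) hy.
have Y0 : (2%:~R : rat) * nodeY t != 0.
  by rewrite /nodeY !mulf_neq0 ?invr_eq0 ?expf_neq0.
have yNy : (y == - y) = false.
  apply/negP=> /eqP E; move: (asym_neq0 h2y Y0).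
  have -> : 2%:~R * y = y + y by ring.
  by rewrite {1}E addNr eqxx.
rewrite /= eqxx yNy /=.
have hnum := asymD (asymD (asymM (asym_cst 3) (asymM hx hx))
   (asymM (asymM (asym_cst 2) ha2) hx)) ha4.
have hl := asym_div (i := 3) (j := 9) hnum h2y Y0.
rewrite -[3%:R * x ^+ 2]/(3%:~R * (x * x)) -[2%:R * a2]/(2%:~R * a2).
rewrite -[2%:R * y]/(2%:~R * y).
set l := _ / (2%:~R * y) in hl *; set L := _ / (_ * nodeY t) in hl.
have hx3 := asymB (asymB (asymB (asymM hl hl) ha2) hx) hx.
have EX : L * L - 1 - nodeX t - nodeX t = nodeX (t * t).
  rewrite /L /nodeX /nodeY; field.
  by apply/and4P.
exists (l ^+ 2 - a2 - x - x), (l * (x - (l ^+ 2 - a2 - x - x)) - y); split=> //.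
  by rewrite -EX expr2.
have -> : nodeY (t * t) = L * (nodeX t - nodeX (t * t)) - nodeY t.
  rewrite /L /nodeX /nodeY; field.
  by apply/and4P.
apply: asymB hy; apply: asymM hl _; apply: asymB hx _.
by rewrite -EX expr2.
Qed.

Lemma reduces_muln P (t : rat) n : 1 < t -> reduces P t ->
  reduces (ec_muln a2 a4 a6 n.+1 P) (t ^+ n.+1).
Proof.
move=> t_gt1 hP; have t_gt0 : 0 < t by apply: lt_trans t_gt1.
have t1 : t != 1 by rewrite gt_eqF.
(* The cases are [P] itself, the tangent for [2 P], then chords through [P] and a higher
   multiple. *)
elim: n => [|[|n] IHn]; first by rewrite expr1 /=; case: P hP => [[]|].
- rewrite expr2 /=; have -> : ec_add a2 a4 a6 P None = P by case: (P) => [[]|].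
  apply: reduces_double => //; first by rewrite gt_eqF.
  by rewrite gt_eqF // (lt_trans _ t_gt0) // oppr_lt0.
- rewrite exprS; apply: reduces_chord => //.
  + by rewrite gt_eqF // exprn_egt1.
  + by rewrite lt_eqF // -{1}[t]expr1 ltr_eXn2l.
  + by rewrite -exprS gt_eqF // exprn_egt1.
Qed.

(** Only the abscissa is kept: negation preserves it, so the sign of [m] disappears. *)
Lemma reduces_mulz P (t : rat) (m : int) : 1 < t -> reduces P t -> m != 0 ->
  exists x y, ec_mulz a2 a4 a6 m P = Some (x, y) /\ asym 6 x (nodeX (t ^+ `|m|%N)).
Proof.
move=> t_gt1 hP; case: m => [[|n]|n] // _.
- by rewrite /ec_mulz; have [x [y [-> hx _]]] := reduces_muln n t_gt1 hP; exists x, y.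
- rewrite /ec_mulz; have [x [y [-> hx _]]] := reduces_muln n t_gt1 hP.
  by exists x, (- y).
Qed.

Lemma ec_add_none P Q : ec_add a2 a4 a6 P Q = None ->
  [\/ P = None /\ Q = None | exists x y z, P = Some (x, y) /\ Q = Some (x, z)].
Proof.
case: P Q => [[x y]|] [[x' y']|] //=; last by left.
case: (x =P x') => [<-|] //= _; right; by exists x, y, y'.
Qed.

End Multiples.

(** * Independence from the parameters 3 and 5 *)

Lemma exp_3_5_neq (m n : nat) : (0 < m)%N -> (3 : rat) ^+ m <> 5 ^+ n.
Proof.
move=> m0 /eqP; rewrite -!natrX eqr_nat => /eqP E.
have : (3 %| 5 ^ n)%N by rewrite -E dvdn_exp.
by rewrite Euclid_dvdX.
Qed.

Lemma rank_ge2_of_reduces (a2 a4 a6 : Qk) (P Q : ec_point Qk) :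
  asym 6 a2 1 -> asym 12 a4 0 ->
  on_curve a2 a4 a6 P -> on_curve a2 a4 a6 Q ->
  reduces P 3 -> reduces Q 5 -> mw_rank_ge a2 a4 a6 2.
Proof.
move=> ha2 ha4 cP cQ hP hQ.
exists (fun i => if i == 0 then P else Q); split=> [i|c]; first by case: ifP.
rewrite enum_ordSl enum_ordSl enum_ord0 /=.
set m := c _; set n := c _ => E.
suff [m0 n0] : m = 0 /\ n = 0.
  by case=> [[|[|i]] hi] //; [rewrite -[RHS]m0 | rewrite -[RHS]n0];
     congr (c _); apply: val_inj.
have addr_none (R : ec_point Qk) : ec_add a2 a4 a6 R None = R by case: R => [[]|].
rewrite addr_none in E.
have noneP (R : ec_point Qk) (t : rat) (z : int) : 1 < t -> reduces R t ->
    ec_mulz a2 a4 a6 z R = None -> z = 0.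
  move=> t1 hR Ez; apply/eqP; case: eqP => // /eqP z0.
  by have [x [y []]] := reduces_mulz a6 ha2 ha4 t1 hR z0; rewrite Ez.
have [[Em En]|[x [y [z [Em En]]]]] := ec_add_none E.
  by split; [apply: noneP hP Em | apply: noneP hQ En].
have m0 : m != 0 by apply/eqP => m0; rewrite m0 in Em.
have n0 : n != 0 by apply/eqP => n0; rewrite n0 in En.
have [x1 [y1 [E1 h1]]] := reduces_mulz a6 ha2 ha4 (isT : 1 < (3 : rat)) hP m0.
have [x2 [y2 [E2 h2]]] := reduces_mulz a6 ha2 ha4 (isT : 1 < (5 : rat)) hQ n0.
rewrite E1 in Em; rewrite E2 in En.
case: Em En h1 h2 => -> _ [-> _] h1 h2.
(* The common abscissa has a unique leading coefficient, and parameters above 1 cannot be inverse to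
   each other. *)
case: (@exp_3_5_neq `|m| `|n|); first by rewrite absz_gt0.
apply: nodeX_inj (asym_uniq h1 h2); rewrite exprn_egt1 //.
- by rewrite -lt0n absz_gt0.
- by rewrite -lt0n absz_gt0.
Qed.

(** * The two points *)

Lemma asym_a : asym 2 a_k 10.
Proof.
have -> : a_k = kpoly [:: 8; -8; 10] by rewrite /a_k /kpoly /=; ring.
exact: asym_kpoly.
Qed.

Lemma asym_b : asym 3 b_k 1.
Proof.
have -> : b_k = kpoly [:: 0; 20; -4; 1] by rewrite /b_k /kpoly /=; ring.
exact: asym_kpoly.
Qed.

Lemma asym_c : asym 3 c_k 1.
Proof.
have -> : c_k = kpoly [:: -8; -4; 2; 1] by rewrite /c_k /kpoly /=; ring.
exact: asym_kpoly.
Qed.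

Local Notation e1 := (a_k * b_k).
Local Notation e2 := (b_k * c_k).
Local Notation e3 := (a_k * c_k).

(* [x + a b], [x + b c], [x + a c] are [k f g], [4 k (k - 2)^2 f], [(k - 2)^4 g],
   where [f] and [g] are the last two factors of [y]. *)
Definition pointP : ec_point Qk :=
  Some (kpoly [:: 0; -96; 368; -304; 152; -46; 3],
        kpoly [:: 0; 2] * (kpoly [:: -8; 12; -6; 1] *
          (kpoly [:: -16; 4; -8; 1] * kpoly [:: -4; -12; 3]))).

(* The triangle with sides [a_k], [b_k], [c_k] is Heronian, with area
   [4 k (k^2 - 4)^2].  [pointQ] is the difference of the point with
   [x = -2 area] and the point [(0, a b c)], and [slopeQ] is the slope of the
   line through them. *)
Definition slopeQ : Qk := kpoly [:: -16; -16; -80; 20; -3] / kpoly [:: -4; 2].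

(** Third root on the line of slope [slopeQ], from the sum of the roots; the other two are 0 and
    [-2 area], the list subtracted here. *)
Definition xQ : Qk :=
  slopeQ ^+ 2 - (e1 + e2 + e3) - kpoly [:: 0; -128; 0; 64; 0; -8].

Definition pointQ : ec_point Qk := Some (xQ, a_k * b_k * c_k - slopeQ * xQ).

Lemma on_curve_P :
  on_curve (e1 + e2 + e3) (e1 * e2 + e1 * e3 + e2 * e3) (e1 * e2 * e3) pointP.
Proof. by apply/eqP; rewrite /a_k /b_k /c_k /kpoly /=; ring. Qed.

(* The line [y = l x - r] through [(0, - r)] meets the curve in two further points;
   the hypothesis says that [x1] is the abscissa of one of them. *)
Lemma on_curve_third (K : fieldType) (a2 a4 r l x1 : K) :
  x1 ^+ 2 + (a2 - l ^+ 2) * x1 + a4 + 2 * l * r = 0 ->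
  on_curve a2 a4 (r ^+ 2)
    (Some (l ^+ 2 - a2 - x1, r - l * (l ^+ 2 - a2 - x1))).
Proof.
move=> H; apply/eqP; apply/subr0_eq.
have -> : forall x3, x3 = l ^+ 2 - a2 - x1 ->
  (r - l * x3) ^+ 2 - (x3 ^+ 3 + a2 * x3 ^+ 2 + a4 * x3 + r ^+ 2) =
  - x3 * (x1 ^+ 2 + (a2 - l ^+ 2) * x1 + a4 + 2 * l * r) => //.
  by move=> x3 ->; ring.
by rewrite H mulr0.
Qed.

Lemma on_curve_Q :
  on_curve (e1 + e2 + e3) (e1 * e2 + e1 * e3 + e2 * e3) (e1 * e2 * e3) pointQ.
Proof.
have -> : e1 * e2 * e3 = (a_k * b_k * c_k) ^+ 2 by ring.
apply: on_curve_third.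
set D := kpoly [:: -4; 2].
have D0 : D != 0 by apply: asym_neq0 (asym_kpoly _) _.
have lD : slopeQ * D = kpoly [:: -16; -16; -80; 20; -3] by rewrite /slopeQ divfK.
apply: (mulfI (expf_neq0 2 D0)); rewrite mulr0.
(* Regrouped so that [slopeQ] occurs only in the polynomial [slopeQ * D], which leaves a polynomial
   identity for [ring]. *)
have -> : forall l x1 a2 a4 r : Qk,
  D ^+ 2 * (x1 ^+ 2 + (a2 - l ^+ 2) * x1 + a4 + 2 * l * r) =
  D ^+ 2 * (x1 ^+ 2 + a2 * x1 + a4) - (l * D) ^+ 2 * x1 + 2 * (l * D) * D * r.
  by move=> *; ring.
rewrite lD /D /a_k /b_k /c_k /kpoly /=.
ring.
Qed.

Lemma asym_slopeQ : asym 3 slopeQ ((-3)%:~R / 2%:~R).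
Proof.
have hN : asym 4 _ _ := asym_kpoly [:: -16; -16; -80; 20; -3].
have hD : asym 1 _ _ := asym_kpoly [:: -4; 2].
exact: (@asym_div 3 1 _ _ _ _ hN hD).
Qed.

Lemma asym_roots_sum : asym 6 (e1 + e2 + e3) 1.
Proof.
(* Only [b c] reaches degree 6; [a b] and [a c] have degree 5. *)
have -> : (1 : rat) = 0 + 1 * 1 + 0 by rewrite mulr1 add0r addr0.
apply: asymD (asymD _ (asymM asym_b asym_c)) _.
- by apply: asym_lt (asymM asym_a asym_b).
- by apply: asym_lt (asymM asym_a asym_c).
Qed.

Lemma asym_xQ : asym 6 xQ (nodeX 5).
Proof.
have -> : nodeX 5 = (-3)%:~R / 2%:~R * ((-3)%:~R / 2%:~R) - 1 - 0 by [].
apply: asymB; last by apply: asym_lt (asym_kpoly _).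
by apply: asymB asym_roots_sum; rewrite expr2; apply: asymM asym_slopeQ asym_slopeQ.
Qed.

(* E : y^2 = (x + a b)(x + b c)(x + a c) over Q(k) has rank >= 2. *)
Theorem theorem4p2 :
  mw_rank_ge_roots (a_k * b_k) (b_k * c_k) (a_k * c_k) 2.
Proof.
have hab := asymM asym_a asym_b.
have hbc := asymM asym_b asym_c.
have hac := asymM asym_a asym_c.
apply: rank_ge2_of_reduces on_curve_P on_curve_Q _ _.
- exact: asym_roots_sum.
(* The three products have degrees 11, 10 and 11, all below 12. *)
- have -> : (0 : rat) = 0 + 0 + 0 by rewrite !addr0.
  by apply: asymD (asymD (asym_lt _ (asymM hab hbc)) (asym_lt _ (asymM hab hac)))
                  (asym_lt _ (asymM hbc hac)).
- do 2!eexists; split; first reflexivity.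
  + have -> : nodeX 3 = 3%:~R by []; exact: asym_kpoly.
  + have -> : nodeY 3 = 2%:~R * (1%:~R * (1%:~R * 3%:~R)) by [].
    apply: (asymM (asym_kpoly _) (asymM (asym_kpoly _) _)).
    exact: asymM (asym_kpoly _) (asym_kpoly _).
- do 2!eexists; split; [reflexivity | exact: asym_xQ |].
  (* The term [a b c] has degree 8, hence contributes 0 in degree 9. *)
  have -> : nodeY 5 = 0 - ((-3)%:~R / 2%:~R) * nodeX 5 by [].
  apply: asymB (asymM asym_slopeQ asym_xQ).
  by apply: asym_lt (asymM hab asym_c).
Qed.
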